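(* For every integer $n\ge1$ and every integer $i$, $$2\,b_i(n)=c_i(n),$$ where $b_i(n)=\big|\{S\subseteq[n-1]:\sum_{s\in S}s=i\}\big|$ and $c_i(n)=\big|\{S\subseteq[n]:\operatorname{sdeg}S=i\}\big|$.
   Context: For a positive integer $n$, $[n]=\{1,\dots,n\}$ (and $[0]=\emptyset$). For $S\subseteq[n]$, define $\deg S=|\{(p,q)\in([n]\setminus S)\times S:p<q\}|$ and $\operatorname{sdeg}S=\binom{|S|}{2}+\deg S=|\{(p,q)\in[n]\times S:p<q\}|$. *)

(* Defs.v *)
From mathcomp Require Import all_boot all_algebra.

Set Implicit Arguments.
Unset Strict Implicit.
Unset Printing Implicit Defensive.

(* [n] = {1, ..., n} lives inside 'I_n.+1 = {0, ..., n}, so that the elements *)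
(* of a subset of [n] are the integers themselves and not their predecessors. *)
Definition interval1 (n : nat) : {set 'I_n.+1} := [set k : 'I_n.+1 | 0 < k].

Definition deg (n : nat) (S : {set 'I_n.+1}) : nat :=
  #|[set pq in setX (interval1 n :\: S) S | pq.1 < pq.2]|.

Definition sdeg (n : nat) (S : {set 'I_n.+1}) : nat := 'C(#|S|, 2) + deg S.

Lemma card_ltn_pairs (m : nat) (S : {set 'I_m}) :
  #|[set pq in setX S S | pq.1 < pq.2]| = 'C(#|S|, 2).
Proof.
set L := [set _ in _ | _].
set G := [set pq in setX S S | pq.2 < pq.1].
set D := [set (p, p) | p in S].
have cG : #|G| = #|L|.
  rewrite -(card_imset (mem L) (f := fun pq => (pq.2, pq.1))); last first.
    by move=> [a b] [c d] [-> ->].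
  apply: eq_card => -[a b]; apply/idP/imsetP => [|[[c d]]].
    by rewrite !inE /= => /andP[/andP[aS bS] ba]; exists (b, a); rewrite ?inE /= ?aS ?bS.
  by rewrite !inE /= => /andP[/andP[cS dS] cd] [-> ->]; rewrite cS dS.
have cD : #|D| = #|S| by rewrite card_imset // => a b [].
have inD a b : ((a, b) \in D) = (a \in S) && (a == b).
  apply/imsetP/andP => [[c cS [-> ->]]|[aS /eqP <-]]; first by rewrite cS.
  by exists a.
have XE : setX S S = L :|: G :|: D.
  apply/setP => -[a b]; rewrite !in_setU inD !inE /= -andb_orr -neq_ltn -val_eqE /=.
  by case: eqVneq => [/val_inj ->|_]; rewrite ?andbF ?andbT ?orbF //= andbb.
have dLG : [disjoint L & G].
  rewrite -setI_eq0; apply/eqP/setP => -[a b]; rewrite !inE /=.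
  by case: ltngtP; rewrite ?andbF.
have dD : [disjoint L :|: G & D].
  rewrite -setI_eq0; apply/eqP/setP => -[a b]; rewrite in_setI inD !inE /=.
  by case: eqVneq => [->|_]; rewrite ?ltnn ?andbF.
have := cardsX S S; rewrite XE !cardsU !(disjoint_setI0 _) // cards0 !subn0.
rewrite cG cD addnn => E; rewrite bin2 -subn1 mulnBr muln1 -E addnK.
by rewrite doubleK.
Qed.

Lemma sdegE (n : nat) (S : {set 'I_n.+1}) : S \subset interval1 n ->
  sdeg S = #|[set pq in setX (interval1 n) S | pq.1 < pq.2]|.
Proof.
move=> /subsetP sS; rewrite /sdeg -card_ltn_pairs /deg.
rewrite -(cardsID (setX S setT) [set pq in setX (interval1 n) S | _]).
congr (_ + _); apply: eq_card => -[a b]; rewrite !inE /=.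
  by have := sS a; rewrite inE; case: (a \in S) => [->|_]; rewrite /= ?andbF ?andbT.
by case: (a \in S); rewrite ?andbF ?andbT.
Qed.

Definition b (i : int) (n : nat) : nat :=
  #|[set S in powerset (interval1 n.-1) | Posz (\sum_(s in S) s) == i]|.

Definition c (i : int) (n : nat) : nat :=
  #|[set S in powerset (interval1 n) | Posz (sdeg S) == i]|.

(* Main.v *)
Require Import Defs.
From mathcomp Require Import all_boot all_algebra.

(** The number of [p] in [n] below [q] is [q - 1], so [sdeg S] is the sum of
    [S] shifted down by one. Hence [c i n] counts the subsets of {0, ..., n-1}
    with sum [i], and whether such a subset contains 0 does not affect its sum. *)

Lemma card_interval1_ltn (n : nat) (q : 'I_n.+1) :
  #|[set p in interval1 n | p < q]| = q.-1.
Proof.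
rewrite -subn1 -[RHS]muln1 -sum_nat_const_nat.
(* The range from 1 to [q] is widened to [0..n], its bounds becoming conditions, so that the sum
   runs over ['I_n.+1]. *)
rewrite (big_nat_widen _ _ n.+1) ?(ltnW (ltn_ord q)) //.
rewrite (big_nat_widenl _ 0) // big_mkord sum1dep_card.
by apply: eq_card => p; rewrite !inE andbC.
Qed.

Lemma sdeg_sum (n : nat) (S : {set 'I_n.+1}) : S \subset interval1 n ->
  sdeg S = \sum_(q in S) q.-1.
Proof.
move=> sS; rewrite sdegE //.
under eq_bigr => q _ do rewrite -card_interval1_ltn -sum1_card.
(* Swapping the sums puts [p] first, matching the pairs [(p, q)] of [sdegE]. *)
rewrite (exchange_big_dep predT) //= pair_big_dep /= sum1dep_card.
by apply: eq_card => -[p q]; rewrite !inE /= andbAC andbC.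
Qed.

(** [lift ord0] is the shift [t -> t + 1], which cancels the predecessor in [sdeg_sum]. *)
Lemma sdeg_lift (m : nat) (T : {set 'I_m.+1}) :
  sdeg (lift ord0 @: T) = \sum_(t in T) t.
Proof.
rewrite sdeg_sum; last by apply/subsetP => _ /imsetP[t _ ->]; rewrite inE.
by rewrite big_imset //= => x y _ _; apply: lift_inj.
Qed.

Lemma c_succ (m : nat) (i : int) :
  c i m.+1 = #|[set T : {set 'I_m.+1} | Posz (\sum_(t in T) t) == i]|.
Proof.
have inj : injective (lift (@ord0 m.+1)) by apply: lift_inj.
rewrite -(card_imset _ (imset_inj inj)); apply: eq_card => S; rewrite !inE.
apply/andP/imsetP => [[sS Si]|[T]].
  have defS : S = lift ord0 @: (lift ord0 @^-1: S).
    apply/setP => x; apply/idP/imsetP => [xS|[t + ->]]; last by rewrite inE.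
    (* With 0 written as [val ord0], [ltnn] refutes the case [x = ord0]. *)
    have := subsetP sS x xS; rewrite inE -[0]/(val (@ord0 m.+1)).
    case: (unliftP ord0 x) => [t xE _|->]; last by rewrite ltnn.
    by exists t; rewrite // inE -xE.
  by exists (lift ord0 @^-1: S); rewrite // inE -sdeg_lift -defS.
rewrite inE -sdeg_lift => Ti ->; split=> //.
by apply/subsetP => _ /imsetP[t _ ->]; rewrite inE.
Qed.

Lemma subset_interval1 (m : nat) (T : {set 'I_m.+1}) :
  (T \subset interval1 m) = (ord0 \notin T).
Proof.
apply/subsetP/idP => [sT|T0 t tT].
  by apply/negP => /sT; rewrite inE.
by rewrite inE lt0n; apply: contraNneq T0 => t0; rewrite -(_ : t = ord0) //; apply: val_inj.
Qed.

(** Inserting 0 is a sum-preserving bijection from the sets avoiding 0, counted by [b i m.+1], onto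
    those containing it. *)
Lemma card_sum_ord (m : nat) (i : int) :
  #|[set T : {set 'I_m.+1} | Posz (\sum_(t in T) t) == i]| = 2 * b i m.+1.
Proof.
set A := [set T | _]; pose Z := [set T : {set 'I_m.+1} | ord0 \in T].
have bE : #|A :\: Z| = b i m.+1.
  by apply: eq_card => T; rewrite !inE subset_interval1.
rewrite -(cardsID Z) bE mul2n -addnn; congr (_ + _); rewrite -bE.
have -> : A :&: Z = [set ord0 |: T | T in A :\: Z].
  apply/setP => T; apply/idP/imsetP => [|[U]].
    rewrite !inE => /andP[Ti T0]; exists (T :\ ord0); last by rewrite setD1K.
    by move: Ti; rewrite !inE eqxx (big_setD1 ord0).
  by rewrite !inE => /andP[U0 Ui] ->; rewrite setU11 big_setU1 // Ui.
(* On sets avoiding 0, removing 0 undoes the insertion. *)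
apply: card_in_imset => T U; rewrite !inE => /andP[T0 _] /andP[U0 _] eTU.
by rewrite -(setU1K T0) eTU setU1K.
Qed.

Theorem mainTheorem7 (n : nat) (i : int) (hn : 1 <= n) : 2 * b i n = c i n.
Proof. by case: n hn => // m _; rewrite c_succ card_sum_ord. Qed.
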